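(* Work in 3-dimensional Euclidean space $\mathbb{R}^3$, hyperbolic space $H^3$, or elliptic space $\mathbb{RP}^3$. Let $a_1,a_2,a_3$ be a triple of lines with a common skewer (i.e. there is a line meeting each $a_i$ at right angle), and let $b_1,b_2,b_3$ be another triple of lines with a common skewer. Assume the lines are in general position. Then the three lines $$S(S(a_1,b_2),S(a_2,b_1)),\quad S(S(a_1,b_3),S(a_3,b_1)),\quad S(S(a_2,b_3),S(a_3,b_2))$$ share a skewer, i.e. there is a line that intersects all three of them at right angle.
   Context: A skewer of two lines is a line that intersects both of them at right angle; $S(a,b)$ denotes the skewer of $a$ and $b$. (For two skew lines in $\mathbb{R}^3$ it is their common perpendicular; for two lines meeting at one point it is the line through that point perpendicular to both.) Several lines share a skewer if some line intersects each of them at right angle. Elliptic space $\mathbb{RP}^3$ is the quotient of the unit sphere $S^3\subset\mathbb{R}^4$ by the antipodal map; a line $\ell$ is the projectivization of a 2-plane in $\mathbb{R}^4$ and its dual line $\ell^*$ is the projectivization of the orthogonal complement of that plane. In $\mathbb{RP}^3$ a generic pair of lines has exactly two skewers, dual to each other. There ''unique'' means unique up to replacing the skewer by its dual, $S(a,b)$ is either of the two, and the statement is asserted for any choice. General position: each time one needs to draw a skewer of two lines, this operation is well defined and unique (in elliptic space, up to duality). This is required for every expression $S(\cdot,\cdot)$ in the statement and for the common skewer in the conclusion, i.e. some two of the three concluding lines have a unique skewer. It holds on a Zariski open subset of the set of initial data (two triples of lines with common skewers). *)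

(* Defs.v *)
From HB Require Import structures.
From mathcomp Require Import all_boot all_order all_algebra.
From mathcomp Require Import classical_sets reals.

Set Implicit Arguments.
Unset Strict Implicit.
Unset Printing Implicit Defensive.

Import Order.TTheory GRing.Theory Num.Theory.

Local Open Scope classical_set_scope.
Local Open Scope ring_scope.

(* Points are described through ambient vectors: [vec p] may represent a point,
   and tangent vectors at that point are ambient vectors as well.
   - [direction p u]: p represents a point of the space and u is a nonzero
     tangent vector at p;
   - [metric] is the bilinear form whose restriction to each tangent space is
     the Riemannian metric;
   - [geodesic p u] is the complete geodesic through p in the direction u;
   - [same_skewer] is the equivalence up to which a skewer is unique. *)
Record geometry (R : realType) := Geometry {
  point : Type;
  vec : Type;
  metric : vec -> vec -> R;
  direction : vec -> vec -> Prop;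
  geodesic : vec -> vec -> set point;
  same_skewer : set point -> set point -> Prop
}.

Record line (R : realType) (G : geometry R) := Line {
  line_set :> set (point G);
  lineP : exists p u : vec G, direction p u /\ line_set = geodesic p u
}.

Definition right_angle (R : realType) (G : geometry R) (l m : line G) : Prop :=
  exists p u v : vec G,
    [/\ direction p u, direction p v,
        l = geodesic p u :> set (point G), m = geodesic p v :> set (point G)
      & metric u v = 0].

Definition skewer (R : realType) (G : geometry R) (s a b : line G) : Prop :=
  right_angle s a /\ right_angle s b.

Definition share_skewer (R : realType) (G : geometry R) (a b c : line G) : Prop :=
  exists s : line G, [/\ right_angle s a, right_angle s b & right_angle s c].

(* [is_S s a b] reads "S(a, b) is well defined and unique, and s is (a choice
   of) S(a, b)". *)
Definition is_S (R : realType) (G : geometry R) (s a b : line G) : Prop :=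
  skewer s a b /\ forall t : line G, skewer t a b -> same_skewer s t.

Definition has_unique_skewer (R : realType) (G : geometry R) (a b : line G) : Prop :=
  exists s : line G, is_S s a b.

Definition dot (R : realType) (n : nat) (u v : 'rV[R]_n) : R :=
  \sum_(i < n) u 0 i * v 0 i.

Definition plane (R : realType) (n : nat) (p u : 'rV[R]_n) : set 'rV[R]_n :=
  [set x | x \in <<[:: p; u]>>%VS].

Definition euclidean (R : realType) : geometry R :=
  @Geometry R 'rV[R]_3 'rV[R]_3
    (@dot R 3)
    (fun _ u => u != 0)
    (fun p u => [set x | exists t : R, x = p + t *: u])
    (fun l m => l = m).

(* Hyperboloid model; coordinate 0 is the timelike one. *)
Definition lorentz (R : realType) (u v : 'rV[R]_4) : R :=
  \sum_(i < 3) u 0 (lift 0 i) * v 0 (lift 0 i) - u 0 0 * v 0 0.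

Definition hyperboloid (R : realType) : set 'rV[R]_4 :=
  [set x | lorentz x x = -1 /\ 0 < x 0 0].

Definition hyperbolic (R : realType) : geometry R :=
  @Geometry R 'rV[R]_4 'rV[R]_4
    (@lorentz R)
    (fun p u => [/\ hyperboloid p, u != 0 & lorentz p u = 0])
    (fun p u => plane p u `&` @hyperboloid R)
    (fun l m => l = m).

Definition sphere (R : realType) : set 'rV[R]_4 := [set x | dot x x = 1].

(* A point of RP^3 is an antipodal class {x, -x} with x in S^3; its tangent
   space is represented by the tangent space of S^3 at x. *)
Definition antipodal (R : realType) (x : 'rV[R]_4) : set 'rV[R]_4 := [set x; - x].

Definition projectivization (R : realType) (P : set 'rV[R]_4) : set (set 'rV[R]_4) :=
  [set antipodal x | x in P `&` @sphere R].

Definition orthogonal_complement (R : realType) (P : set 'rV[R]_4) : set 'rV[R]_4 :=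
  [set y | forall x, P x -> dot x y = 0].

Definition dual_line (R : realType) (l m : set (set 'rV[R]_4)) : Prop :=
  exists P : {vspace 'rV[R]_4},
    [/\ (\dim P = 2)%N, l = projectivization [set x | x \in P]
      & m = projectivization (orthogonal_complement [set x | x \in P])].

Definition elliptic (R : realType) : geometry R :=
  @Geometry R (set 'rV[R]_4) 'rV[R]_4
    (@dot R 4)
    (fun p u => [/\ sphere p, u != 0 & dot p u = 0])
    (fun p u => projectivization (plane p u))
    (fun l m => m = l \/ dual_line l m).

Inductive space_kind := Euclidean | Hyperbolic | Elliptic.

Definition model (R : realType) (X : space_kind) : geometry R :=
  match X with
  | Euclidean => euclidean R
  | Hyperbolic => hyperbolic R
  | Elliptic => elliptic R
  end.

(* Main.v *)
From HB Require Import structures.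
Require Import Defs.
From mathcomp Require Import all_boot all_order all_algebra ring lra.
From mathcomp Require Import boolp classical_sets reals.

(** The three geometries are treated at once by giving a line coordinates in
    A^3, where A = R[j], j^2 = q, and q = -1, 0, 1 for the hyperbolic,
    Euclidean and elliptic space (complex, dual and split-complex numbers).
    A line through p in the direction u has a Pluecker vector (D, M), a pair of
    vectors of R^3, which is read as D + j M.  For the standard bilinear product
    of A^3, the vector of a line has an invertible square, and two lines meet
    at a right angle if and only if their vectors are orthogonal: one component
    of the product says that the lines meet, the other that the angle is right.
    Up to scalars of A, every vector with an invertible square comes from a
    line.

    A skewer of a and b is thus a line orthogonal to both vectors.  If it is
    unique, then the square of a x b is invertible and the vector of the skewer
    is a scalar multiple of a x b ([unique_skewer_unit], [skewer_cross]):
    otherwise a x b is annihilated by some nonzero scalar nu, and the skewer s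
    can be perturbed to s + r nu (a x s) for some real r, another skewer.
    Consequently the assertion becomes that the three vectors
    (a_i x b_j) x (a_j x b_i) have a vanishing determinant, given that the a_i
    are orthogonal to one vector and the b_i to another.
    This is the theorem of Pappus, in the plane over A; it is proved over every
    commutative ring, as an identity between brackets ([pappus]).  The unique
    skewer of two of the three concluding lines is proportional to the cross
    product of these two, so the vanishing determinant says that it is
    orthogonal to the third ([skewer_pappus]).

    It remains to verify the dictionary in each geometry
    ([eucl_skewer_coordinates], [hyp_skewer_coordinates],
    [ell_skewer_coordinates]); the last two share the computations in R^4 with
    the form x0 y0 + q (x1 y1 + x2 y2 + x3 y3). *)

Set Implicit Arguments.
Unset Strict Implicit.
Unset Printing Implicit Defensive.

Import Order.TTheory GRing.Theory Num.Theory.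

Local Open Scope ring_scope.

(** * Vector algebra in A^3 over a commutative ring *)

Section Vectors.
Variable A : comPzRingType.
Implicit Types (u v w x y : 'rV[A]_3) (k : A).

Definition i0 : 'I_3 := ord0.
Definition i1 : 'I_3 := inord 1.
Definition i2 : 'I_3 := inord 2.

Definition sdot u v : A := u 0 i0 * v 0 i0 + u 0 i1 * v 0 i1 + u 0 i2 * v 0 i2.

Definition vec3 (a b c : A) : 'rV[A]_3 :=
  \row_i (if i == i0 then a else if i == i1 then b else c).

Definition cross u v : 'rV[A]_3 :=
  vec3 (u 0 i1 * v 0 i2 - u 0 i2 * v 0 i1)
       (u 0 i2 * v 0 i0 - u 0 i0 * v 0 i2)
       (u 0 i0 * v 0 i1 - u 0 i1 * v 0 i0).

Definition bracket u v w := sdot u (cross v w).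

Lemma vec3E a b c : (vec3 a b c 0 i0 = a) * (vec3 a b c 0 i1 = b) * (vec3 a b c 0 i2 = c).
Proof. by split; [split|]; rewrite mxE // /i0 /i1 /i2 -!val_eqE /= ?inordK. Qed.

Lemma forall3 (P : 'I_3 -> Prop) : P i0 -> P i1 -> P i2 -> forall i, P i.
Proof.
move=> P0 P1 P2 [[|[|[|//]]] lti].
- by have -> : Ordinal lti = i0 by exact: val_inj.
- by have -> : Ordinal lti = i1 by apply: val_inj; rewrite /= inordK.
- by have -> : Ordinal lti = i2 by apply: val_inj; rewrite /= inordK.
Qed.

Lemma eq_vec3 u v : u 0 i0 = v 0 i0 -> u 0 i1 = v 0 i1 -> u 0 i2 = v 0 i2 -> u = v.
Proof. by move=> h0 h1 h2; apply/rowP; apply: forall3. Qed.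

Lemma sum3 (F : 'I_3 -> A) : \sum_(i < 3) F i = F i0 + F i1 + F i2.
Proof.
rewrite !big_ord_recl big_ord0 addr0 !addrA; congr (_ + F _ + F _);
by apply: val_inj; rewrite /= inordK.
Qed.

End Vectors.

Ltac ring3 := intros; rewrite /bracket /sdot; try apply: eq_vec3; rewrite /cross ?(vec3E, mxE); ring.

Section VectorIdentities.
Variable A : comPzRingType.
Implicit Types (a b s t u v w x y : 'rV[A]_3) (k : A).

Lemma sdotC u v : sdot u v = sdot v u. Proof. ring3. Qed.
Lemma sdotDl u v w : sdot (u + v) w = sdot u w + sdot v w. Proof. ring3. Qed.
Lemma sdotDr u v w : sdot w (u + v) = sdot w u + sdot w v. Proof. ring3. Qed.
Lemma sdotZl k u v : sdot (k *: u) v = k * sdot u v. Proof. ring3. Qed.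
Lemma sdotZr k u v : sdot u (k *: v) = k * sdot u v. Proof. ring3. Qed.
Lemma sdot0l u : sdot 0 u = 0. Proof. ring3. Qed.
Lemma crossZl k u v : cross (k *: u) v = k *: cross u v. Proof. ring3. Qed.
Lemma crossZr k u v : cross u (k *: v) = k *: cross u v. Proof. ring3. Qed.
Lemma crossDr u v w : cross w (u + v) = cross w u + cross w v. Proof. ring3. Qed.
Lemma cross_sq u : cross u u = 0. Proof. ring3. Qed.
Lemma cross_anti u v : cross u v = - cross v u. Proof. ring3. Qed.
Lemma bracket_rot u v w : bracket u v w = bracket v w u. Proof. ring3. Qed.
Lemma bracket_swap u v w : bracket u v w = - bracket v u w. Proof. ring3. Qed.
Lemma bracketZ k l m u v w : bracket (k *: u) (l *: v) (m *: w) = k * l * m * bracket u v w.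
Proof. ring3. Qed.
Lemma sdot_crossl u v : sdot u (cross u v) = 0. Proof. ring3. Qed.
Lemma sdot_crossr u v : sdot u (cross v u) = 0. Proof. ring3. Qed.
Lemma cross_cross u v w : cross u (cross v w) = sdot u w *: v - sdot u v *: w.
Proof. ring3. Qed.
Lemma lagrange u v :
  sdot (cross u v) (cross u v) = sdot u u * sdot v v - sdot u v ^+ 2.
Proof. ring3. Qed.
(** Both sides represent the meet of the lines ab and xy of the projective
    plane, the right one as a combination of x and y. *)
Lemma cross_cross_bracket a b x y :
  cross (cross a b) (cross x y) = bracket a b y *: x - bracket a b x *: y.
Proof. ring3. Qed.

(** u x v is annihilated by the cross product with s, hence proportional to s; in
    this form no division by the square of s is needed. *)
Lemma cross_orth s u v : sdot s u = 0 -> sdot s v = 0 ->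
  sdot s s *: cross u v = sdot s (cross u v) *: s.
Proof.
move=> su sv; have := cross_cross s s (cross u v).
rewrite [cross s (cross u v)]cross_cross su sv !scale0r subrr.
have -> : cross s 0 = 0 :> 'rV[A]_3 by ring3.
by move/esym/eqP; rewrite subr_eq0 => /eqP <-.
Qed.

Lemma bracket_coplanar k s a1 a2 a3 : k * sdot s s = 1 ->
  sdot s a1 = 0 -> sdot s a2 = 0 -> sdot s a3 = 0 -> bracket a1 a2 a3 = 0.
Proof.
move=> ks s1 s2 s3; rewrite /bracket -[cross _ _]scale1r -ks -scalerA.
by rewrite (cross_orth s2 s3) !sdotZr (sdotC a1) s1 !mulr0.
Qed.

(** Cramer's formula gives [a1, a2, a3] x as the left-hand side, over any ring. *)
Lemma coplanar_relation a1 a2 a3 x : bracket a1 a2 a3 = 0 ->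
  sdot x a1 *: cross a2 a3 + sdot x a2 *: cross a3 a1 + sdot x a3 *: cross a1 a2 = 0.
Proof.
move=> h; transitivity (bracket a1 a2 a3 *: x); last by rewrite h scale0r.
by ring3.
Qed.

(** Four of the eight terms contain a repeated vector. *)
Lemma bracket_expand x2 x3 y1 y2 m1 n1 m2 n2 m3 n3 :
  bracket (m1 *: x2 - n1 *: y1) (m2 *: x3 - n2 *: y1) (m3 *: x3 - n3 *: y2) =
  m1 * n2 * n3 * bracket x2 y1 y2 + n1 * m2 * n3 * bracket y1 x3 y2
  - m1 * m2 * n3 * bracket x2 x3 y2 - m1 * n2 * m3 * bracket x2 y1 x3.
Proof. ring3. Qed.

(** Each vector (a_i x b_j) x (a_j x b_i) is a combination of one a and one b.
    After expansion only brackets with two a's or two b's remain.  As the a's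
    are orthogonal to s, a_i x a_j = p_ij s, and [a_i, a_j, x] = p_ij (s . x);
    similarly with q_ij and t for the b's.  The sum of the four terms then
    factors through the Cramer relations of the a's and of the b's.  Invertible
    squares of s and t replace the assumption that s and t are nonzero. *)
Lemma pappus k l s t a1 a2 a3 b1 b2 b3 :
  k * sdot s s = 1 -> l * sdot t t = 1 ->
  sdot s a1 = 0 -> sdot s a2 = 0 -> sdot s a3 = 0 ->
  sdot t b1 = 0 -> sdot t b2 = 0 -> sdot t b3 = 0 ->
  bracket (cross (cross a1 b2) (cross a2 b1))
          (cross (cross a1 b3) (cross a3 b1))
          (cross (cross a2 b3) (cross a3 b2)) = 0.
Proof.
move=> ks lt sa1 sa2 sa3 tb1 tb2 tb3.
have ca x y : sdot s x = 0 -> sdot s y = 0 ->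
    cross x y = (k * sdot s (cross x y)) *: s.
  by move=> sx sy; rewrite -scalerA -cross_orth // scalerA ks scale1r.
have cb x y : sdot t x = 0 -> sdot t y = 0 ->
    cross x y = (l * sdot t (cross x y)) *: t.
  by move=> tx ty; rewrite -scalerA -cross_orth // scalerA lt scale1r.
have [c12 c13 c23] : [/\ exists p, cross a1 a2 = p *: s, exists p, cross a1 a3 = p *: s
   & exists p, cross a2 a3 = p *: s] by split; eexists; exact: ca.
have [e12 e13 e23] : [/\ exists p, cross b1 b2 = p *: t, exists p, cross b1 b3 = p *: t
   & exists p, cross b2 b3 = p *: t] by split; eexists; exact: cb.
move: c12 c13 c23 e12 e13 e23 => [p12 A12] [p13 A13] [p23 A23] [q12 B12] [q13 B13] [q23 B23].
have relA : p23 * sdot t a1 - p13 * sdot t a2 + p12 * sdot t a3 = 0.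
  have := coplanar_relation t (bracket_coplanar ks sa1 sa2 sa3).
  rewrite (cross_anti a3) A12 A13 A23 => /(congr1 (fun v => k * sdot s v)).
  rewrite scalerN !scalerA !sdotDr -scaleNr !sdotZr => h.
  transitivity (k * sdot s s * (p23 * sdot t a1 - p13 * sdot t a2 + p12 * sdot t a3)).
    by rewrite ks mul1r.
  transitivity (k * sdot s 0); last by rewrite sdotC sdot0l mulr0.
  by rewrite -h; ring.
have relB : q23 * sdot s b1 - q13 * sdot s b2 + q12 * sdot s b3 = 0.
  have := coplanar_relation s (bracket_coplanar lt tb1 tb2 tb3).
  rewrite (cross_anti b3) B12 B13 B23 => /(congr1 (fun v => l * sdot t v)).
  rewrite scalerN !scalerA !sdotDr -scaleNr !sdotZr => h.
  transitivity (l * sdot t t * (q23 * sdot s b1 - q13 * sdot s b2 + q12 * sdot s b3)).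
    by rewrite lt mul1r.
  transitivity (l * sdot t 0); last by rewrite sdotC sdot0l mulr0.
  by rewrite -h; ring.
have aab x y p z : cross x y = p *: s -> bracket x y z = p * sdot s z.
  by move=> xy; rewrite -bracket_rot /bracket xy sdotZr sdotC.
have abb x y z p : cross y z = p *: t -> bracket x y z = p * sdot t x.
  by move=> yz; rewrite /bracket yz sdotZr sdotC.
rewrite !cross_cross_bracket bracket_expand.
have -> : bracket a1 b2 b1 = - q12 * sdot t a1 by apply: abb; rewrite cross_anti B12 scaleNr.
have -> : bracket a1 b3 b1 = - q13 * sdot t a1 by apply: abb; rewrite cross_anti B13 scaleNr.
have -> : bracket a2 b3 b2 = - q23 * sdot t a2 by apply: abb; rewrite cross_anti B23 scaleNr.
have -> : bracket a2 b1 b2 = q12 * sdot t a2 by exact: abb.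
have -> : bracket b1 a3 b2 = - (q12 * sdot t a3) by rewrite bracket_swap (abb _ _ _ _ B12).
have -> : bracket a1 b2 a2 = - (p12 * sdot s b2).
  by rewrite bracket_swap bracket_rot (aab _ _ _ _ A12).
have -> : bracket a1 b3 a3 = - (p13 * sdot s b3).
  by rewrite bracket_swap  bracket_rot (aab _ _ _ _ A13).
have -> : bracket a2 b3 a3 = - (p23 * sdot s b3).
  by rewrite bracket_swap bracket_rot (aab _ _ _ _ A23).
have -> : bracket a2 b1 a3 = - (p23 * sdot s b1).
  by rewrite bracket_swap bracket_rot (aab _ _ _ _ A23).
have -> : bracket a2 a3 b2 = p23 * sdot s b2 by exact: aab.
have hA : p13 * sdot t a2 = p23 * sdot t a1 + p12 * sdot t a3.
  by apply/eqP; rewrite -subr_eq0 -oppr_eq0 -[X in _ == X]relA; apply/eqP; ring.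
have hB : q13 * sdot s b2 = q23 * sdot s b1 + q12 * sdot s b3.
  by apply/eqP; rewrite -subr_eq0 -oppr_eq0 -[X in _ == X]relB; apply/eqP; ring.
(* both products in the large parentheses equal p13 (t.a2) q13 (s.b2) *)
transitivity (q12 * p23 * sdot t a1 * sdot s b3 *
  ((q13 * sdot s b2) * (p23 * sdot t a1 + p12 * sdot t a3)
   - (p13 * sdot t a2) * (q23 * sdot s b1 + q12 * sdot s b3))); first by ring.
by rewrite -hA -hB; ring.
Qed.
End VectorIdentities.

(** * The quadratic algebra R[j] with j^2 = q *)

(** The pair (a, b) stands for a + b j.  The alias keeps q in the type, and hides
    the componentwise product of pairs. *)
Definition quad (R : realType) (q : R) : Type := (R * R)%type.

Section QuadRing.
Variables (R : realType) (q : R).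
HB.instance Definition _ := GRing.Zmodule.copy (quad q) (R * R)%type.
Definition quad_one : quad q := (1, 0).
Definition quad_mul (z w : quad q) : quad q :=
  (z.1 * w.1 + q * (z.2 * w.2), z.1 * w.2 + z.2 * w.1).
Fact quad_mulA : associative quad_mul.
Proof. by move=> x y z; congr pair; rewrite /=; ring. Qed.
Fact quad_mulC : commutative quad_mul.
Proof. by move=> x y; congr pair; rewrite /=; ring. Qed.
Fact quad_mul1 : left_id quad_one quad_mul.
Proof. by case=> x y; congr pair; rewrite /=; ring. Qed.
Fact quad_mulD : left_distributive quad_mul +%R.
Proof. by move=> x y z; congr pair; rewrite /=; ring. Qed.
Fact quad_one_neq0 : quad_one != 0.
Proof. by apply/eqP => -[/eqP]; rewrite oner_eq0. Qed.
HB.instance Definition _ := GRing.Zmodule_isComNzRing.Build (quad q)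
  quad_mulA quad_mulC quad_mul1 quad_mulD quad_one_neq0.
End QuadRing.

Section QuadTheory.
Variables (R : realType) (q : R).
Local Notation A := (quad q).
Implicit Types (z w k : A) (u v : 'rV[A]_3).

Lemma quadP z w : z.1 = w.1 -> z.2 = w.2 -> z = w.
Proof. by case: z w => ? ? [? ?] /= -> ->. Qed.

Lemma quadD1 z w : (z + w).1 = z.1 + w.1. Proof. by []. Qed.
Lemma quadD2 z w : (z + w).2 = z.2 + w.2. Proof. by []. Qed.
Lemma quadM1 z w : (z * w).1 = z.1 * w.1 + q * (z.2 * w.2). Proof. by []. Qed.
Lemma quadM2 z w : (z * w).2 = z.1 * w.2 + z.2 * w.1. Proof. by []. Qed.

Definition qreal (r : R) : A := (r, 0).
Definition qconj z : A := (z.1, - z.2).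
Definition qnorm z : R := z.1 ^+ 2 - q * z.2 ^+ 2.

Lemma qnormM z w : qnorm (z * w) = qnorm z * qnorm w.
Proof. by rewrite /qnorm quadM1 quadM2; ring. Qed.

Lemma qnorm_conj z : qconj z * z = qreal (qnorm z).
Proof. by apply: quadP; rewrite ?quadM1 ?quadM2 /= /qnorm; ring. Qed.

Lemma qnorm_unit z : qnorm z != 0 -> exists k, k * z = 1.
Proof.
move=> nz; exists (qreal (qnorm z)^-1 * qconj z).
rewrite -mulrA qnorm_conj; apply: quadP; rewrite ?quadM1 ?quadM2 /=.
  by rewrite mulVf // !mulr0 addr0.
by ring.
Qed.

Lemma scale_unit_eq0 (V : lmodType A) z (v : V) : qnorm z != 0 -> z *: v = 0 -> v = 0.
Proof.
by move=> /qnorm_unit[k kz] zv; rewrite -[v]scale1r -kz -scalerA zv scaler0.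
Qed.

Lemma mul_unit_eq0 z w : qnorm z != 0 -> z * w = 0 -> w = 0.
Proof. exact: (@scale_unit_eq0 A^o). Qed.

(** The conjugate of a nonzero z of norm zero annihilates it. *)
Lemma nonunit_annihilator z : qnorm z = 0 -> exists2 k, k != 0 & k * z = 0.
Proof.
move=> z0; have [->|nz] := eqVneq z 0.
  by exists 1; rewrite ?oner_neq0 // mulr0.
exists (qconj z); last by rewrite qnorm_conj z0.
apply: contraNneq nz => -[z1 /eqP]; rewrite oppr_eq0 => /eqP z2.
by apply/eqP/quadP.
Qed.

(** The norm is a quadratic polynomial in r^2 with a nonzero constant term, so it
    does not vanish at all of r = 1, 2, 3. *)
Lemma unit_perturbation z w : qnorm z != 0 ->
  exists2 r : R, r != 0 & qnorm (z + qreal (r ^+ 2) * w) != 0.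
Proof.
move=> z0; apply: contrapT => none.
have root r : r != 0 -> qnorm (z + qreal (r ^+ 2) * w) = 0.
  by move=> r0; apply/eqP/negPn/negP => h; apply: none; exists r.
move/negP: z0; apply; apply/eqP.
have := root 1 (oner_neq0 _).
have := root 2%:R ltac:(by rewrite pnatr_eq0).
have := root 3%:R ltac:(by rewrite pnatr_eq0).
rewrite /qnorm !quadD1 !quadD2 !quadM1 !quadM2 /= => h3 h2 h1.
nra.
Qed.

(** * The theorem for lines with coordinates in A^3 *)

(** The dictionary between a geometry and orthogonality in A^3.  The scalar in
    [coord_onto] is forced to be invertible by [coord_unit].  The last clause
    says that the coordinates of dual lines are proportional over A, although
    their real Pluecker vectors are not. *)
Record skewer_coordinates (G : geometry R) (pl : line G -> 'rV[A]_3) : Prop := {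
  coord_unit : forall l, qnorm (sdot (pl l) (pl l)) != 0;
  coord_right_angle : forall l m, right_angle l m <-> sdot (pl l) (pl m) = 0;
  coord_onto : forall v, qnorm (sdot v v) != 0 -> exists l k, pl l = k *: v;
  coord_same_skewer : forall s t : line G, same_skewer s t -> cross (pl s) (pl t) = 0
}.

Section Abstract.
Variables (G : geometry R) (pl : line G -> 'rV[A]_3).
Hypothesis plP : skewer_coordinates pl.
Implicit Types a b c d l m s t : line G.

(** Otherwise the square of w = a x b has norm zero.  As w is, up to a unit, mu
    times the vector of s, mu has norm zero as well.  If nu mu = 0 with nu
    nonzero, then nu w = 0, and the vectors s + r nu (a x s) with r real stay
    orthogonal to a and b.  For distinct parallel lines in Euclidean space this
    translates s along them; for Clifford parallels in elliptic space it rotates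
    one of the two factors of so(4) = so(3) + so(3).  Such a vector is
    proportional to s only if r nu = 0. *)
Lemma unique_skewer_unit s a b : is_S s a b ->
  qnorm (sdot (cross (pl a) (pl b)) (cross (pl a) (pl b))) != 0.
Proof.
case=> -[/(coord_right_angle plP) sa /(coord_right_angle plP) sb] uniq.
have su := coord_unit plP s; have au := coord_unit plP a.
set w := cross _ _; apply/negP => /eqP w0.
pose mu := sdot (pl s) w.
have sw : sdot (pl s) (pl s) *: w = mu *: pl s by exact: cross_orth.
have mu0 : qnorm mu = 0.
  have : sdot (sdot (pl s) (pl s) *: w) (sdot (pl s) (pl s) *: w) =
         mu * mu * sdot (pl s) (pl s) by rewrite sw sdotZl sdotZr; ring.
  rewrite sdotZl sdotZr => /(congr1 qnorm); rewrite !qnormM w0 !mulr0 => /esym/eqP.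
  by rewrite !mulf_eq0 (negbTE su) orbF orbb => /eqP.
have [nu nu0 numu] := nonunit_annihilator mu0.
have nuw : nu *: w = 0.
  apply: (scale_unit_eq0 su); rewrite scalerA mulrC -scalerA sw scalerA numu.
  by rewrite scale0r.
pose t := cross (pl a) (pl s).
have [r r0 unit'] := unit_perturbation (nu ^+ 2 * sdot t t) su.
pose s' := pl s + (qreal r * nu) *: t.
have s's' : sdot s' s' = sdot (pl s) (pl s) + qreal (r ^+ 2) * (nu ^+ 2 * sdot t t).
  have st : sdot (pl s) t = 0 by rewrite sdot_crossr.
  have -> : qreal (r ^+ 2) = qreal r * qreal r.
    by apply: quadP; rewrite ?quadM1 ?quadM2 /=; ring.
  rewrite /s' !sdotDl !sdotDr !sdotZl !sdotZr (sdotC t (pl s)) st; ring.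
have [l [k plk]] := coord_onto plP (v := s') ltac:(by rewrite s's').
have s'a : sdot s' (pl a) = 0.
  by rewrite /s' sdotDl sa sdotZl (sdotC t) sdot_crossl mulr0 addr0.
have s'b : sdot s' (pl b) = 0.
  rewrite /s' sdotDl sb sdotZl -mulrA (sdotC t) -/(bracket _ _ _) -bracket_rot.
  rewrite /bracket -sdotZr cross_anti scalerN nuw.
  by rewrite oppr0 sdotC sdot0l mulr0 addr0.
have ls : skewer l a b.
  by split; apply/(coord_right_angle plP); rewrite plk sdotZl ?s'a ?s'b mulr0.
have := coord_same_skewer plP (uniq _ ls).
have ku : qnorm k != 0.
  apply: contraNneq (coord_unit plP l) => k0.
  by rewrite plk sdotZl qnormM k0 mul0r.
rewrite plk crossZr => /(scale_unit_eq0 ku).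
rewrite /s' crossDr cross_sq add0r crossZr /t cross_cross sa scale0r subr0.
rewrite !scalerA => /(congr1 (sdot (pl a))); rewrite sdotZr -mulrA mulrC.
rewrite (sdotC _ 0) sdot0l -mulrA => /(mul_unit_eq0 su) /(mul_unit_eq0 au).
move=> rnu; move/negP: nu0; apply; apply/eqP; apply: (@mul_unit_eq0 (qreal r)) => //.
by rewrite /qnorm /= expr0n mulr0 subr0 expf_neq0.
Qed.

(** In A^3, orthogonality to a and b forces proportionality to a x b once the
    square of a x b is invertible. *)
Lemma skewer_cross s a b : is_S s a b -> exists k, pl s = k *: cross (pl a) (pl b).
Proof.
move=> sab; have wu := unique_skewer_unit sab.
case: sab => -[/(coord_right_angle plP) sa /(coord_right_angle plP) sb] _.
have [k kw] := qnorm_unit wu; set w := cross _ _ in wu kw *.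
exists (k * sdot w (pl s)).
have sw : cross w (pl s) = 0.
  by rewrite cross_anti cross_cross sa sb !scale0r subrr oppr0.
have := cross_cross w w (pl s).
rewrite sw -[X in cross w X](scale0r w) crossZr scale0r => /esym/eqP.
rewrite subr_eq0 => /eqP h.
by rewrite -scalerA h scalerA kw scale1r.
Qed.

(** By [skewer_cross] the determinant of the three concluding vectors is a multiple
    of the one in [pappus]. *)
Theorem skewer_pappus a1 a2 a3 b1 b2 b3 c12 c21 c13 c31 c23 c32 d12 d13 d23 :
  share_skewer a1 a2 a3 -> share_skewer b1 b2 b3 ->
  is_S c12 a1 b2 -> is_S c21 a2 b1 ->
  is_S c13 a1 b3 -> is_S c31 a3 b1 ->
  is_S c23 a2 b3 -> is_S c32 a3 b2 ->
  is_S d12 c12 c21 -> is_S d13 c13 c31 -> is_S d23 c23 c32 ->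
  has_unique_skewer d12 d13 \/ has_unique_skewer d12 d23 \/
    has_unique_skewer d13 d23 ->
  share_skewer d12 d13 d23.
Proof.
move=> [s [/(coord_right_angle plP) sa1 /(coord_right_angle plP) sa2
  /(coord_right_angle plP) sa3]].
move=> [t [/(coord_right_angle plP) tb1 /(coord_right_angle plP) tb2
  /(coord_right_angle plP) tb3]].
move=> /skewer_cross[k12 C12] /skewer_cross[k21 C21].
move=> /skewer_cross[k13 C13] /skewer_cross[k31 C31].
move=> /skewer_cross[k23 C23] /skewer_cross[k32 C32].
move=> /skewer_cross[l12 D12] /skewer_cross[l13 D13] /skewer_cross[l23 D23].
have [ks ksP] := qnorm_unit (coord_unit plP s).
have [kt ktP] := qnorm_unit (coord_unit plP t).
have br : bracket (pl d12) (pl d13) (pl d23) = 0.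
  rewrite D12 C12 C21 crossZl crossZr !scalerA D13 C13 C31 crossZl crossZr !scalerA.
  rewrite D23 C23 C32 crossZl crossZr !scalerA bracketZ.
  by rewrite (pappus ksP ktP) // mulr0.
have conclude (e u v w : line G) : is_S e u v -> bracket (pl u) (pl v) (pl w) = 0 ->
    [/\ right_angle e u, right_angle e v & right_angle e w].
  move=> euv uvw; have [k ek] := skewer_cross euv; case: euv => -[eu ev] _.
  split=> //; apply/(coord_right_angle plP).
  by rewrite ek sdotZl sdotC -/(bracket _ _ _) bracket_rot uvw mulr0.
case=> [[e /conclude h]|[[e /conclude h]|[e /conclude h]]].
- by exists e; apply: h.
- have [|? ? ?] := h d13; last by exists e.
  by rewrite bracket_rot bracket_swap bracket_rot bracket_rot br oppr0.
- have [|? ? ?] := h d12; last by exists e.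
  by rewrite -bracket_rot.
Qed.
End Abstract.
End QuadTheory.

(** * Representing vectors of A^3 by perpendicular pairs of real vectors *)

Section RealVectors.
Variable R : realType.
Implicit Types (u v x : 'rV[R]_3).

Lemma sdot_ge0 u : 0 <= sdot u u.
Proof. by rewrite /sdot -!expr2 !addr_ge0 // sqr_ge0. Qed.

Lemma sdot_eq0 u : sdot u u = 0 -> u = 0.
Proof.
rewrite /sdot -!expr2 => /eqP; rewrite !paddr_eq0 ?addr_ge0 ?sqr_ge0 // !sqrf_eq0.
by move=> /andP[/andP[/eqP h0 /eqP h1] /eqP h2]; apply: eq_vec3; rewrite mxE.
Qed.

Lemma sdot_gt0 u : u != 0 -> 0 < sdot u u.
Proof.
by move=> u0; rewrite lt0r sdot_ge0 andbT; apply: contraNneq u0 => /sdot_eq0->.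
Qed.

Lemma cauchy_schwarz u v : sdot u v ^+ 2 <= sdot u u * sdot v v.
Proof. by rewrite -subr_ge0 -lagrange sdot_ge0. Qed.

End RealVectors.

Section QuadVectors.
Variables (R : realType) (q : R).
Local Notation A := (quad q).
Implicit Types (D M : 'rV[R]_3) (z : A).

Definition qvec D M : 'rV[A]_3 := \row_i (D 0 i, M 0 i).

Lemma qvec_surj (v : 'rV[A]_3) : exists D M, v = qvec D M.
Proof.
exists (\row_i (v 0 i).1), (\row_i (v 0 i).2); apply/rowP => i.
by rewrite !mxE -surjective_pairing.
Qed.

Lemma sdot_qvec D M D' M' : sdot (qvec D M) (qvec D' M') =
  (sdot D D' + q * sdot M M', sdot D M' + sdot M D').
Proof.
by rewrite /sdot !mxE; apply: quadP; rewrite ?quadD1 ?quadD2 ?quadM1 ?quadM2 /=; ring.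
Qed.

Lemma cross_qvec D M D' M' : cross (qvec D M) (qvec D' M') =
  qvec (cross D D' + q *: cross M M') (cross D M' + cross M D').
Proof.
by apply: eq_vec3; rewrite /cross !(vec3E, mxE); apply: quadP;
  rewrite ?quadD1 ?quadD2 ?quadM1 ?quadM2 /=; ring.
Qed.

Lemma scale_qvec z D M :
  z *: qvec D M = qvec (z.1 *: D + (q * z.2) *: M) (z.1 *: M + z.2 *: D).
Proof.
by apply/rowP => i; rewrite !mxE; apply: quadP; rewrite ?quadM1 ?quadM2 /=; ring.
Qed.

Lemma qreal_scale r D M : qreal q r *: qvec D M = qvec (r *: D) (r *: M).
Proof. by rewrite scale_qvec /= mulr0 !scale0r !addr0. Qed.

(** The conclusion makes (D, M) the Pluecker vector of a line: D . M = 0 is the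
    Pluecker relation, and the inequality says that the corresponding 2-plane
    meets the quadric of points.  It is reached by making the square of k v a
    positive real number, starting from the square z of v.  For n = sqrt (N z)
    the multiplier k = conj z + n does it, as k^2 z = 2 n^2 (re z + n), unless
    q = -1 and z is a negative real number, when k = j does it.  If D vanishes,
    which happens only for q = 1, then multiplication by j exchanges D and M,
    that is, passes to the dual line. *)
Lemma normal_form v : q = -1 \/ q = 0 \/ q = 1 -> qnorm (sdot v v) != 0 ->
  exists k D M, [/\ k *: v = qvec D M, D != 0, sdot D M = 0 &
                    0 < sdot D D + q * sdot M M].
Proof.
move=> hq vu.
have [k [c c0 kc]] : exists k, exists2 c, 0 < c & k ^+ 2 * sdot v v = qreal q c.
  have := vu; have [D [M ->]] := qvec_surj v; rewrite sdot_qvec /qnorm /=.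
  rewrite (sdotC M D) -mulr2n; set a := _ + q * _; set b := _ *+ 2 => N0.
  (* for q = 1 the norm is nonnegative by the Cauchy-Schwarz inequality *)
  have [Ngt0 a_ge] : 0 < a ^+ 2 - q * b ^+ 2 /\ (q = -1 \/ 0 < a).
    rewrite lt0r N0 /=; have := cauchy_schwarz D M; have := sdot_ge0 D.
    have := sdot_ge0 M; move: N0; rewrite {}/a {}/b.
    move: (sdot D D) (sdot M M) (sdot D M) => x y w.
    case: hq => [->|[->|->]] N0 y0 x0 xy.
    - split; last by left. by rewrite !mulN1r opprK addr_ge0 ?sqr_ge0.
    - split; first by rewrite !mul0r subr0 sqr_ge0.
      right; rewrite mul0r addr0 lt0r x0 andbT; apply: contraNneq N0 => ->.
      by rewrite !mul0r addr0 subr0 expr0n.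
    - have N_ge0 : 0 <= (x + 1 * y) ^+ 2 - 1 * (w *+ 2) ^+ 2.
        have -> : (x + 1 * y) ^+ 2 - 1 * (w *+ 2) ^+ 2 = (x - y) ^+ 2 + 4%:R * (x * y - w ^+ 2).
          by ring.
        by rewrite addr_ge0 ?sqr_ge0 // mulr_ge0 // subr_ge0.
      split=> //; right; rewrite mul1r lt0r addr_ge0 // andbT.
      apply: contraNneq N0 => xy0; move: N_ge0; rewrite !mul1r xy0 expr0n sub0r.
      by rewrite oppr_ge0 => h; rewrite oppr_eq0 eq_le h sqr_ge0.
  pose n := Num.sqrt (a ^+ 2 - q * b ^+ 2).
  have nn : n ^+ 2 = a ^+ 2 - q * b ^+ 2 by rewrite sqr_sqrtr // ltW.
  have n0 : 0 < n by rewrite sqrtr_gt0.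
  have [an|an] := ltP 0 (a + n).
    exists (a + n, - b), (n ^+ 2 * (2%:R * (a + n))).
      by rewrite mulr_gt0 ?exprn_gt0 // mulr_gt0.
    have qb : q * b ^+ 2 = a ^+ 2 - n ^+ 2 by rewrite nn; ring.
    rewrite expr2; apply: quadP; rewrite ?quadM1 ?quadM2 /=.
      transitivity (((a + n) ^+ 2 + q * b ^+ 2) * a - 2%:R * (q * b ^+ 2) * (a + n)).
        by ring.
      by rewrite qb; ring.
    transitivity (b * ((a + n) ^+ 2 + q * b ^+ 2 - 2%:R * a * (a + n))); first by ring.
    by rewrite qb; ring.
  have qE : q = -1 by case: a_ge => // a0; move: an; rewrite leNgt addr_gt0.
  have a0 : 0 < - a by lra.
  have b0 : b = 0.
    have : b ^+ 2 <= 0 by move: nn; rewrite qE => nn; nra.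
    by rewrite le_eqVlt ltNge sqr_ge0 orbF sqrf_eq0 => /eqP.
  exists (0, 1), (- a) => //.
  by rewrite expr2 qE b0; apply: quadP; rewrite ?quadM1 ?quadM2 /=; ring.
have [D [M kv]] := qvec_surj (k *: v).
have : sdot (k *: v) (k *: v) = qreal q c.
  by rewrite sdotZl sdotZr -kc; ring.
rewrite kv sdot_qvec (sdotC M D) => -[DD DM].
have {}DM : sdot D M = 0 by lra.
have [D0|D0] := eqVneq D 0; last by exists k, D, M; rewrite DD.
(* the square is q times that of M, so q is positive *)
have q1 : q = 1.
  move: DD; rewrite D0 sdot0l add0r; have := sdot_ge0 M.
  case: hq => [->|[->|->]] // M0; first by lra.
  by rewrite mul0r => h; move: c0; rewrite -h ltxx.
exists (((0, 1) : A) * k), M, D; split; last by rewrite q1 mul1r addrC -[sdot M M]mul1r -q1 DD.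
- by rewrite -scalerA kv scale_qvec /= q1 D0 !scale0r !scale1r mul1r scale1r !add0r ?scaler0 ?addr0.
- by apply: contraTneq c0 => M0; rewrite -DD D0 M0 sdot0l mulr0 addr0 ltxx.
- by rewrite sdotC.
Qed.
End QuadVectors.

(** * Coordinates of lines from coordinates of pointed directions *)

Section Representatives.
Variables (R : realType) (q : R) (G : geometry R).
Variable c : vec G -> vec G -> 'rV[quad q]_3.
Implicit Types (l m : line G) (p u v w : vec G) (D M : 'rV[R]_3).

Definition base_point l : vec G := sval (cid (lineP l)).
Definition base_direction l : vec G := sval (cid (svalP (cid (lineP l)))).
Definition line_coord l := c (base_point l) (base_direction l).

Lemma base_lineP l : direction (base_point l) (base_direction l) /\
  l = geodesic (base_point l) (base_direction l) :> set (Defs.point G).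
Proof. exact: svalP (cid (svalP (cid (lineP l)))). Qed.

Hypothesis q_kind : q = -1 \/ q = 0 \/ q = 1.

Hypothesis c_unit : forall p u, direction p u -> qnorm (sdot (c p u) (c p u)) != 0.

Hypothesis c_geodesic : forall p u p' u', direction p u -> direction p' u' ->
  geodesic p u = geodesic p' u' -> exists r, c p' u' = qreal q r *: c p u.

Hypothesis c_right_angle : forall p u v, direction p u -> direction p v ->
  metric u v = 0 -> sdot (c p u) (c p v) = 0.

Hypothesis c_meet : forall p u p' u', direction p u -> direction p' u' ->
  sdot (c p u) (c p' u') = 0 ->
  exists w v v', [/\ direction w v, direction w v', geodesic p u = geodesic w v,
    geodesic p' u' = geodesic w v' & metric v v' = 0].

Hypothesis c_onto : forall D M, D != 0 -> sdot D M = 0 ->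
  0 < sdot D D + q * sdot M M ->
  exists p u r, direction p u /\ c p u = qreal q r *: qvec q D M.

Hypothesis c_same_skewer : forall p u p' u', direction p u -> direction p' u' ->
  same_skewer (geodesic p u) (geodesic p' u') -> cross (c p u) (c p' u') = 0.

Lemma line_coordE l p u : direction p u -> l = geodesic p u :> set (Defs.point G) ->
  exists r, line_coord l = qreal q r *: c p u.
Proof.
by move=> pu lpu; have [dl gl] := base_lineP l; apply: c_geodesic; rewrite -?gl.
Qed.

(** Reduces the dictionary to statements about points and directions.  The choice
    of a point and a direction on each line is harmless, because changing them
    multiplies c by a real number. *)
Lemma line_coord_skewer_coordinates : skewer_coordinates line_coord.
Proof.
split.
- by move=> l; have [dl _] := base_lineP l; exact: c_unit.
- move=> l m; split.
    move=> [p [u [v [pu pv lu mv uv]]]].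
    have [r ->] := line_coordE pu lu; have [r' ->] := line_coordE pv mv.
    by rewrite sdotZl sdotZr c_right_angle // !mulr0.
  have [dl gl] := base_lineP l; have [dm gm] := base_lineP m.
  case/(c_meet dl dm) => w [v [v' [wv wv' lv mv vv']]].
  by exists w, v, v'; split=> //; rewrite ?gl ?gm.
- move=> v /(normal_form q_kind)[k [D [M [kv D0 DM DDMM]]]].
  have [p [u [r [pu cpu]]]] := c_onto D0 DM DDMM.
  pose l := Line (ex_intro _ p (ex_intro _ u (conj pu erefl))) : line G.
  have [r' lr'] := line_coordE (l := l) pu erefl.
  by exists l, (qreal q r' * (qreal q r * k)); rewrite lr' cpu -kv !scalerA mulrA.
- move=> s t; have [ds gs] := base_lineP s; have [dt gt] := base_lineP t.
  by rewrite gs gt; exact: c_same_skewer.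
Qed.

End Representatives.

(** * Euclidean space *)

Section Euclidean.
Variable R : realType.
Implicit Types (p u v w x D M : 'rV[R]_3).
Local Notation G := (euclidean R).

Lemma dot3E u v : dot u v = sdot u v.
Proof. by rewrite /dot sum3. Qed.

Definition eucl_coord (p u : vec G) : 'rV[quad (0 : R)]_3 := qvec 0 u (cross p u).

Lemma eucl_geodesicP p u p' u' : @direction R G p' u' ->
  @geodesic R G p u = @geodesic R G p' u' ->
  (exists t, p' = p + t *: u) /\ exists t, u' = t *: u.
Proof.
move=> _ e.
have [t pt] : @geodesic R G p u p' by rewrite e; exists 0; rewrite scale0r addr0.
have [t' pt'] : @geodesic R G p u (p' + u') by rewrite e; exists 1; rewrite scale1r.
split; first by exists t.
by exists (t' - t); transitivity (p' + u' - p'); [ring3 | rewrite pt' pt; ring3].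
Qed.

Lemma eucl_geodesic_shift p u t : @geodesic R G p u = @geodesic R G (p + t *: u) u.
Proof.
apply/seteqP; split=> x [k ->] /=.
  by exists (k - t); rewrite scalerBl addrACA -addrA subrr addr0.
by exists (t + k); rewrite scalerDl addrA.
Qed.

(** For two lines with perpendicular directions u and u' and vanishing mutual
    moment, p' - p is orthogonal to u x u', hence a combination of u and u';
    splitting it gives the common point. *)
Lemma eucl_skewer_coordinates : skewer_coordinates (line_coord eucl_coord).
Proof.
have geo (p u p' u' : vec G) : direction p u -> direction p' u' ->
    geodesic p u = geodesic p' u' ->
    exists r, eucl_coord p' u' = qreal 0 r *: eucl_coord p u.
  move=> pu pu' /(eucl_geodesicP pu')[[t ->] [t' ->]]; exists t'.
  by rewrite /eucl_coord qreal_scale; congr qvec; ring3.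
apply: line_coord_skewer_coordinates => //; first by right; left.
- move=> p u /= u0; rewrite sdot_qvec /qnorm /= !mul0r subr0 addr0.
  by rewrite expf_neq0 // gt_eqF // sdot_gt0.
- move=> p u v pu pv /=; rewrite dot3E sdot_qvec => uv; apply: quadP => /=.
    by rewrite uv mul0r addr0.
  by ring3.
- move=> p u p' u' /= u0 u0'; rewrite sdot_qvec => -[]; rewrite mul0r addr0 => uu' h.
  pose d := p' - p; pose a := sdot d u / sdot u u; pose a' := sdot d u' / sdot u' u'.
  have uP : sdot u u != 0 by rewrite gt_eqF // sdot_gt0.
  have uP' : sdot u' u' != 0 by rewrite gt_eqF // sdot_gt0.
  (* the component of d along the common perpendicular *)
  pose x := d - a *: u - a' *: u'.
  have xE y : sdot x y = sdot d y - a * sdot u y - a' * sdot u' y by rewrite /x; ring3.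
  have xu : sdot x u = 0 by rewrite xE (sdotC u') uu' mulr0 subr0 mulfVK ?subrr.
  have xu' : sdot x u' = 0 by rewrite xE uu' mulr0 subr0 mulfVK ?subrr.
  have xuu' : sdot x (cross u u') = 0.
    transitivity (- (sdot u (cross p' u') + sdot (cross p u) u')); last by rewrite h oppr0.
    by rewrite /x /d; ring3.
  have x0 : x = 0.
    apply: sdot_eq0; have := cross_orth xu xu'; rewrite xuu' scale0r.
    move/(congr1 (sdot (cross u u'))); rewrite sdotZr lagrange uu' expr0n subr0.
    rewrite (sdotC _ 0) sdot0l => /eqP; rewrite !mulf_eq0 (negbTE uP) (negbTE uP') !orbF.
    by move/eqP.
  exists (p + a *: u), u, u'; split=> //.
  + exact: eucl_geodesic_shift.
  + have -> : p + a *: u = p' + (- a') *: u'.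
      apply/eqP; rewrite -subr_eq0 -oppr_eq0 -[X in _ == X]x0 /x /d.
      by apply/eqP; ring3.
    exact: eucl_geodesic_shift.
  + by rewrite dot3E.
(* the foot of the perpendicular from the origin *)
- move=> D M D0 DM _; exists ((sdot D D)^-1 *: cross D M), D, 1; split=> //.
  rewrite qreal_scale !scale1r /eucl_coord; congr qvec.
  rewrite crossZl cross_anti cross_cross DM scale0r sub0r opprK.
  by rewrite scalerA mulVf ?scale1r // gt_eqF // sdot_gt0.
- move=> p u p' u' pu pu' /(geo _ _ _ _ pu pu')[r ->].
  by rewrite crossZr cross_sq scaler0.
Qed.

End Euclidean.

(** * Vectors and planes in R^4 *)

Section FourVectors.
Variable R : realType.
Implicit Types (p u v w x y : 'rV[R]_4) (q : R).

Definition head p : R := p 0 0.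
Definition tail p : 'rV[R]_3 := \row_i p 0 (lift 0 i).
Definition vec4 (h : R) (t : 'rV[R]_3) : 'rV[R]_4 :=
  \row_j (if unlift 0 j is Some i then t 0 i else h).

Lemma head_vec4 h t : head (vec4 h t) = h.
Proof. by rewrite /head mxE unlift_none. Qed.
Lemma tail_vec4 h t : tail (vec4 h t) = t.
Proof. by apply/rowP => i; rewrite !mxE liftK. Qed.

Lemma eq_vec4 x y : head x = head y -> tail x = tail y -> x = y.
Proof.
move=> h t; apply/rowP => j; case: (unliftP 0 j) => [i ->|-> //].
by have /rowP/(_ i) := t; rewrite !mxE.
Qed.

(** The determinant of the four vectors, written through the Pluecker vectors of
    the planes (p, u) and (p', u') (Laplace expansion along two rows). *)
Definition wedge4 p u p' u' : R :=
  sdot (head p *: tail u - head u *: tail p) (cross (tail p') (tail u')) +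
  sdot (cross (tail p) (tail u)) (head p' *: tail u' - head u' *: tail p').

Lemma wedge4_dependent p u p' u' : wedge4 p u p' u' = 0 ->
  exists a b a' b', [/\ a *: p + b *: u = a' *: p' + b' *: u' &
    ~ [/\ a = 0, b = 0, a' = 0 & b' = 0]].
Proof.
move=> h; pose F (i j : nat) : R := nth 0 [:: p; u; p'; u'] i 0 (inord j).
pose M : 'M[R]_4 := \matrix_(i, j) F i j.
have detM : \det M = wedge4 p u p' u'.
  have FE i : (F i 0%N = head (nth 0 [:: p; u; p'; u'] i))
     * (F i 1%N = tail (nth 0 [:: p; u; p'; u'] i) 0 i0)
     * (F i 2%N = tail (nth 0 [:: p; u; p'; u'] i) 0 i1)
     * (F i 3%N = tail (nth 0 [:: p; u; p'; u'] i) 0 i2).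
    by do ![split]; rewrite /F /head ?mxE; congr (_ _ _); apply: val_inj;
      rewrite /= ?inordK.
  do 3!rewrite !(expand_det_row _ 0) !big_ord_recl !big_ord0 /cofactor.
  rewrite !det_mx11 !mxE /= /bump /= ?addn0 ?add0n ?add1n.
  rewrite !FE /= /wedge4 /sdot /cross !vec3E !mxE.
  by ring.
have /eqP/det0P[v v0 vM] : \det M = 0 by rewrite detM.
pose c k := v 0 (inord k).
have comb j : c 0%N * p 0 j + c 1%N * u 0 j + c 2%N * p' 0 j + c 3%N * u' 0 j = 0.
  have /rowP/(_ j) := vM; rewrite !mxE !big_ord_recl big_ord0 !mxE /= addr0 !addrA.
  rewrite /F /= /bump /= inord_val => <-.
  by do !congr (_ + _); congr (_ * _); congr (v _ _); apply: val_inj; rewrite /= inordK.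
exists (c 0%N), (c 1%N), (- c 2%N), (- c 3%N); split.
  apply/rowP => j; rewrite !mxE; apply/eqP; rewrite -subr_eq0 -[X in _ == X](comb j).
  by apply/eqP; ring.
move=> [c0 c1 /eqP]; rewrite oppr_eq0 => /eqP c2 /eqP; rewrite oppr_eq0 => /eqP c3.
move/negP: v0; apply; apply/eqP/rowP => j; rewrite mxE -[j]inord_val -/(c j).
by case: j => [[|[|[|[|//]]]] ltj] /=.
Qed.
End FourVectors.

Section Planes.
Variables (R : realType) (n : nat).
Implicit Types (p u v w x : 'rV[R]_n).

Lemma planeP p u x : plane p u x <-> exists a b, x = a *: p + b *: u.
Proof.
rewrite /plane /= span_cons span_seq1; split.
  by move=> /memv_addP[_ /vlineP[a ->] [_ /vlineP[b ->] ->]]; exists a, b.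
by move=> [a [b ->]]; apply: memv_add; apply/memvZ/memv_line.
Qed.

Lemma plane_left p u : plane p u p.
Proof. by apply/planeP; exists 1, 0; rewrite scale1r scale0r addr0. Qed.

Lemma plane_right p u : plane p u u.
Proof. by apply/planeP; exists 0, 1; rewrite scale1r scale0r add0r. Qed.

Lemma planeZ p u k x : plane p u x -> plane p u (k *: x).
Proof. exact: memvZ. Qed.

Lemma sub_plane p u w v : plane p u w -> plane p u v -> (plane w v `<=` plane p u)%classic.
Proof.
by move=> pw pv x /planeP[a [b ->]]; apply: memvD; apply: memvZ.
Qed.

Lemma plane_change p u w v a b a' b' : w = a *: p + b *: u -> v = a' *: p + b' *: u ->
  a * b' - b * a' != 0 -> plane p u = plane w v.
Proof.
move=> wE vE d0; apply/seteqP; split; apply: sub_plane.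
- apply/planeP; exists (b' / (a * b' - b * a')), (- b / (a * b' - b * a')).
  by rewrite wE vE; apply/rowP => j; rewrite !mxE; field.
- apply/planeP; exists (- a' / (a * b' - b * a')), (a / (a * b' - b * a')).
  by rewrite wE vE; apply/rowP => j; rewrite !mxE; field.
- by apply/planeP; exists a, b.
- by apply/planeP; exists a', b'.
Qed.
End Planes.

(** * Pluecker vectors for a quadric in R^4 *)

(** The form below is the scalar product for q = 1 and the opposite of the Lorentz
    product for q = -1, so that points satisfy form p p = 1 in both cases, and
    the metric on tangent vectors is q times the form. *)
Section Quadric.
Variables (R : realType) (q : R).
Hypothesis q_sign : q = -1 \/ q = 1.
Implicit Types (p u v w x y : 'rV[R]_4) (D M : 'rV[R]_3).

Definition form x y : R := head x * head y + q * sdot (tail x) (tail y).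

Lemma formC x y : form x y = form y x.
Proof. by rewrite /form /sdot; ring. Qed.
Lemma formDl x y z : form (x + y) z = form x z + form y z.
Proof. by rewrite /form /head /sdot !mxE; ring. Qed.
Lemma formZl k x y : form (k *: x) y = k * form x y.
Proof. by rewrite /form /head /sdot !mxE; ring. Qed.
Lemma formDr x y z : form z (x + y) = form z x + form z y.
Proof. by rewrite formC formDl !(formC z). Qed.
Lemma formZr k x y : form x (k *: y) = k * form x y.
Proof. by rewrite formC formZl (formC x). Qed.

Definition formE := (formDl, formDr, formZl, formZr).

(** For q = -1 this is the reversed Cauchy-Schwarz inequality: a vector orthogonal
    to a timelike one is spacelike. *)
Lemma form_orthogonal p y : 0 < form p p -> form p y = 0 -> y != 0 ->
  0 < q * form y y.
Proof.
rewrite /form => pp py y0.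
have [t0|t0] := eqVneq (tail y) 0.
  have h0 : head y != 0.
    apply: contraNneq y0 => h0; apply/eqP/eq_vec4; rewrite ?t0 ?h0.
      by rewrite /head mxE.
    by apply/rowP => i; rewrite !mxE.
  have dot0 z : sdot z 0 = 0 :> R by rewrite sdotC sdot0l.
  move: pp py; rewrite t0 !dot0 !mulr0 !addr0.
  case: q_sign => ->; last by move=> _ _; rewrite mul1r -expr2 exprn_even_gt0.
  move=> pp /eqP; rewrite mulf_eq0 (negbTE h0) orbF => /eqP p0; move: pp.
  by rewrite p0; have := sdot_ge0 (tail p); lra.
have := sdot_gt0 t0; have := cauchy_schwarz (tail p) (tail y); have := sdot_ge0 (tail p).
move: pp py; move: (sdot (tail p) (tail p)) (sdot (tail p) (tail y)) (sdot (tail y) (tail y)).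
move: (head p) (head y) => a b x w y'.
case: q_sign => ->; last first.
  by move=> _ _ _ _ y'0; rewrite !mul1r -expr2 ltr_wpDl // sqr_ge0.
rewrite !mulN1r opprD opprK => aa ab x0 wxy y'0.
have wab : w = a * b by lra.
rewrite addrC subr_gt0 -expr2.
have a2 : 0 < a ^+ 2 by rewrite expr2; lra.
rewrite -(ltr_pM2l a2) -exprMn -wab (le_lt_trans wxy) //.
by rewrite ltr_pM2r // expr2; lra.
Qed.

Definition plucker p u : 'rV[quad q]_3 :=
  qvec q (head p *: tail u - head u *: tail p) (cross (tail p) (tail u)).

(** The first component is the Gram determinant that decides whether the first
    plane contains a vector orthogonal to the second plane, the other one is the
    determinant that decides whether the planes meet. *)
Lemma plucker_gram p u p' u' : sdot (plucker p u) (plucker p' u') =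
  (q * (form p p' * form u u' - form p u' * form u p'), wedge4 p u p' u').
Proof.
rewrite sdot_qvec; apply: quadP => //=.
by case: q_sign; rewrite /form => ->; rewrite /sdot /cross !vec3E !mxE; ring.
Qed.

Lemma plucker_change p u a b a' b' :
  plucker (a *: p + b *: u) (a' *: p + b' *: u) = qreal q (a * b' - b * a') *: plucker p u.
Proof.
rewrite qreal_scale; congr qvec.
  by apply/rowP => i; rewrite /head !mxE; ring.
by apply: eq_vec3; rewrite /cross /head !(vec3E, mxE); ring.
Qed.

(** The cross product of A^3 is the Lie bracket of bivectors, which is bilinear in
    the four products of the spanning vectors. *)
Lemma plucker_commutator p u p' u' :
  form p p' = 0 -> form p u' = 0 -> form u p' = 0 -> form u u' = 0 ->
  cross (plucker p u) (plucker p' u') = 0.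
Proof.
pose D x y := head x *: tail y - head y *: tail x.
pose M x y := cross (tail x) (tail y).
move=> pp' pu' up' uu'; rewrite cross_qvec.
have -> : cross (D p u) (D p' u') + q *: cross (M p u) (M p' u') =
    form p p' *: M u u' - form p u' *: M u p' - form u p' *: M p u' + form u u' *: M p p'.
  by rewrite /form /M /D; move: (tail p) (tail u) (tail p') (tail u') (head p) (head u)
    (head p') (head u') => *; case: q_sign => ->; ring3.
have -> : cross (D p u) (M p' u') + cross (M p u) (D p' u') =
    q *: (form p p' *: D u u' - form p u' *: D u p' - form u p' *: D p u' + form u u' *: D p p').
  by rewrite /form /D /M; move: (tail p) (tail u) (tail p') (tail u') (head p) (head u)
    (head p') (head u') => *; case: q_sign => ->; ring3.
rewrite pp' pu' up' uu' !scale0r !subr0 !addr0 scaler0.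
by apply/rowP => i; rewrite !mxE.
Qed.

End Quadric.

(** * Points and tangent directions of a quadric *)

Section Frames.
Variables (R : realType) (q : R).
Hypothesis q_sign : q = -1 \/ q = 1.
Implicit Types (p u v w x y : 'rV[R]_4) (D M : 'rV[R]_3).
Local Notation B := (form q).
Local Notation plucker := (plucker q).

Definition frame p u := [/\ B p p = 1, B p u = 0 & u != 0].

Lemma frame_direction_gt0 p u : frame p u -> 0 < q * B u u.
Proof. by case=> pp pu u0; apply: (form_orthogonal q_sign) pu u0; rewrite pp. Qed.

Lemma frame_direction_neq0 p u : frame p u -> B u u != 0.
Proof. by move/frame_direction_gt0; apply: contraTneq => ->; rewrite mulr0 ltxx. Qed.

Lemma wedge4_common p u v : wedge4 p u p v = 0.
Proof.
by rewrite /wedge4 /sdot /cross !vec3E ![(_ - _ : 'rV_3) _ _]mxE ![(- _ : 'rV_3) _ _]mxE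
  ![(_ *: _ : 'rV_3) _ _]mxE; ring.
Qed.

Lemma frame_plucker_unit p u : frame p u ->
  qnorm (sdot (plucker p u) (plucker p u)) != 0.
Proof.
move=> pu; have := frame_direction_gt0 pu; case: (pu) => pp pu0 _.
rewrite (plucker_gram q_sign) pp pu0 wedge4_common mul1r mul0r subr0 /qnorm /=.
by rewrite expr0n mulr0 subr0 => /lt0r_neq0; exact: expf_neq0.
Qed.

Lemma frame_plucker_orth p u v : B p u = 0 -> B u v = 0 ->
  sdot (plucker p u) (plucker p v) = 0.
Proof.
move=> pu uv; rewrite (plucker_gram q_sign) wedge4_common uv (formC _ u) pu.
by rewrite !mulr0 subr0 mulr0.
Qed.

Lemma plucker_plane p u p' u' : plane p u p' -> plane p u u' ->
  exists r, plucker p' u' = qreal q r *: plucker p u.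
Proof.
move=> /planeP[a [b ->]] /planeP[a' [b' ->]]; rewrite plucker_change.
by exists (a * b' - b * a').
Qed.

Lemma plane_scalel p v k : k != 0 -> plane p v = plane (k *: p) v.
Proof.
move=> k0; apply: (@plane_change _ _ _ _ _ _ k 0 0 1).
- by rewrite scale0r addr0.
- by rewrite scale0r scale1r add0r.
- by rewrite mulr1 mulr0 subr0.
Qed.

(** A singular 2 x 2 matrix has a nonzero left null vector. *)
Lemma degenerate_pairing (a11 a12 a21 a22 : R) : a11 * a22 - a12 * a21 = 0 ->
  exists a b, [/\ a * a11 + b * a21 = 0, a * a12 + b * a22 = 0 & ~ (a = 0 /\ b = 0)].
Proof.
move=> det0.
have [a11_0|n11] := eqVneq a11 0; last first.
  exists a21, (- a11); split; [by ring| |by case=> _ /eqP; rewrite oppr_eq0; exact/negP].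
  by rewrite -[RHS]oppr0 -det0; ring.
have [a21_0|n21] := eqVneq a21 0; last first.
  exists a21, (- a11); split; [by ring| |by case=> /eqP; rewrite (negbTE n21)].
  by rewrite -[RHS]oppr0 -det0; ring.
rewrite a11_0 a21_0; have [a12_0|n12] := eqVneq a12 0.
  exists 1, 0; rewrite a12_0 !mulr0 !mul0r addr0; split=> // -[/eqP].
  by rewrite oner_eq0.
exists a22, (- a12); split; [by ring|by ring|case=> _ /eqP].
by rewrite oppr_eq0; exact/negP.
Qed.

(** The vanishing determinant gives a nonzero w in both planes, the vanishing Gram
    determinant a nonzero v in the first plane orthogonal to the second one.
    The point to check is that w is timelike if q = -1: v is spacelike, being
    orthogonal to the point p', and w is orthogonal to v in a plane of signature
    (1, 1).  So w can be normalised to the common point, from which the lines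
    leave in the orthogonal directions v and v'. *)
Lemma frame_meet p u p' u' : frame p u -> frame p' u' ->
  sdot (plucker p u) (plucker p' u') = 0 ->
  exists w v v', [/\ frame w v, frame w v', plane p u = plane w v,
    plane p' u' = plane w v' & B v v' = 0].
Proof.
move=> fpu fpu'; rewrite (plucker_gram q_sign) => -[/eqP].
have q0 : q != 0 by case: q_sign => ->; rewrite ?oppr_eq0 oner_neq0.
rewrite mulf_eq0 (negbTE q0) /= => /eqP det0.
move=> /wedge4_dependent[a [b [a' [b' [wE nz]]]]].
have [c [d [vp' vu' cd]]] := degenerate_pairing det0.
have uu := frame_direction_neq0 fpu; have uu' := frame_direction_neq0 fpu'.
have quu := frame_direction_gt0 fpu.
case: fpu => pp pu u0; case: fpu' => pp' pu' u0'.
have up : B u p = 0 by rewrite formC.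
have up' : B u' p' = 0 by rewrite formC.
have [w wE1] : exists w, w = a *: p + b *: u by exists (a *: p + b *: u).
have [v vE] : exists v, v = c *: p + d *: u by exists (c *: p + d *: u).
rewrite -wE1 in wE.
have {}vp' : B v p' = 0 by rewrite vE !formE.
have {}vu' : B v u' = 0 by rewrite vE !formE.
have v0 : v != 0.
  apply/negP => /eqP v0; apply: cd.
  have vp : c = B v p by rewrite vE !formE pp up mulr1 mulr0 addr0.
  have vu : d * B u u = B v u by rewrite vE !formE pu mulr0 add0r.
  move: vp vu; rewrite v0 -(scale0r p) !formZl !mul0r => -> /eqP.
  by rewrite mulf_eq0 (negbTE uu) orbF => /eqP.
have w0 : w != 0.
  apply/negP => /eqP w0; apply: nz.
  have wp : a = B w p by rewrite wE1 !formE pp up mulr1 mulr0 addr0.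
  have wu : b * B u u = B w u by rewrite wE1 !formE pu mulr0 add0r.
  have wp' : a' = B w p' by rewrite wE !formE pp' up' mulr1 mulr0 addr0.
  have wu' : b' * B u' u' = B w u' by rewrite wE !formE pu' mulr0 add0r.
  move: wp wu wp' wu'; rewrite w0 -(scale0r p) !formZl !mul0r => -> /eqP.
  rewrite mulf_eq0 (negbTE uu) orbF => /eqP-> -> /eqP.
  by rewrite mulf_eq0 (negbTE uu') orbF => /eqP->.
have vw : B v w = 0 by rewrite wE !formE vp' vu' !mulr0 addr0.
have qvv : 0 < q * B v v.
  by apply: (form_orthogonal q_sign (p := p')); rewrite ?pp' // formC.
have vv : B v v != 0 by apply: contraTneq qvv => ->; rewrite mulr0 ltxx.
(* v and w are orthogonal and v is not null, so they are independent *)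
have dwv : a * d - b * c != 0.
  apply: contraNneq w0 => e.
  have h1 : d *: w - b *: v = 0.
    transitivity ((a * d - b * c) *: p); last by rewrite e scale0r.
    by rewrite wE1 vE; apply/rowP => j; rewrite !mxE; ring.
  have h2 : a *: v - c *: w = 0.
    transitivity ((a * d - b * c) *: u); last by rewrite e scale0r.
    by rewrite wE1 vE; apply/rowP => j; rewrite !mxE; ring.
  have b0 : b = 0.
    have := congr1 (B v) h1; rewrite -scaleNr !formE vw -(scale0r v) formZr.
    rewrite mul0r mulr0 add0r mulNr => /eqP; rewrite oppr_eq0 mulf_eq0 (negbTE vv) orbF.
    by move/eqP.
  have a0 : a = 0.
    have := congr1 (B v) h2; rewrite -scaleNr !formE vw -(scale0r v) formZr.
    by rewrite mul0r mulr0 addr0 => /eqP; rewrite mulf_eq0 (negbTE vv) orbF => /eqP.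
  by rewrite wE1 a0 b0 !scale0r addr0.
(* the Gram determinants of (v, w) and (p, u) have the same sign *)
have ww : 0 < B w w.
  have gram : (q * B v v) * B w w = (a * d - b * c) ^+ 2 * (q * B u u).
    have -> : (q * B v v) * B w w = q * (B v v * B w w - B v w ^+ 2).
      by rewrite vw; ring.
    by rewrite vE wE1 !formE pp pu up; ring.
  by rewrite -(pmulr_rgt0 _ qvv) gram mulr_gt0 // exprn_even_gt0.
(* the vector of the second plane orthogonal to w *)
have [v' vE'] : exists v', v' = - (b' * B u' u') *: p' + a' *: u'.
  by exists (- (b' * B u' u') *: p' + a' *: u').
have wv' : B w v' = 0 by rewrite wE vE' !formE pp' pu' up'; ring.
have wwE : B w w = a' * a' - b' * (- (b' * B u' u')).
  by rewrite wE !formE pp' pu' up'; ring.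
have k0 : 0 < (Num.sqrt (B w w))^-1 by rewrite invr_gt0 sqrtr_gt0.
set k := _^-1 in k0; have kn : k != 0 by rewrite gt_eqF.
have kww : B (k *: w) (k *: w) = 1.
  rewrite !formE mulrA -expr2 exprVn sqr_sqrtr ?ltW // mulVf //.
  by rewrite gt_eqF.
have v'0 : v' != 0.
  apply/negP => /eqP v'0; move: ww; rewrite wwE.
  have := congr1 (B p') v'0; rewrite {1}vE' !formE pp' pu' -{1}(scale0r p') formZr.
  rewrite mulr1 mulr0 addr0 mul0r => ->; rewrite mulr0 subr0.
  have := congr1 (B u') v'0; rewrite {1}vE' !formE up' -{1}(scale0r p') formZr.
  rewrite mulr0 add0r mul0r => /eqP; rewrite mulf_eq0 (negbTE uu') orbF => /eqP ->.
  by rewrite mulr0 ltxx.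
exists (k *: w), v, v'; split.
- by split=> //; rewrite formZl formC vw mulr0.
- by split=> //; rewrite formZl wv' mulr0.
- by rewrite -plane_scalel //; exact: (plane_change wE1 vE).
- rewrite -plane_scalel //; apply: (plane_change wE vE').
  by rewrite -wwE gt_eqF.
- by rewrite vE' !formE vp' vu' !mulr0 addr0.
Qed.

(** The plane spanned by (1, (D x M) / D^2) and (0, D) has the Pluecker vector
    (D, M), by the formula for the Euclidean foot of the perpendicular; the
    square of its first vector is positive by hypothesis. *)
Lemma frame_onto D M : D != 0 -> sdot D M = 0 -> 0 < sdot D D + q * sdot M M ->
  exists p u r, [/\ frame p u, 0 < head p & plucker p u = qreal q r *: qvec q D M].
Proof.
move=> D0 DM pos; have DD := sdot_gt0 D0.
pose p0 := vec4 1 ((sdot D D)^-1 *: cross D M); pose u := vec4 0 D.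
have pp0 : B p0 p0 = (sdot D D + q * sdot M M) / sdot D D.
  rewrite /form !head_vec4 !tail_vec4 sdotZl sdotZr lagrange DM; field.
  by rewrite gt_eqF.
have pu0 : B p0 u = 0.
  by rewrite /form !head_vec4 !tail_vec4 sdotZl sdotC sdot_crossl !mulr0 addr0.
have pp0_gt0 : 0 < B p0 p0 by rewrite pp0 divr_gt0.
have k0 : 0 < (Num.sqrt (B p0 p0))^-1 by rewrite invr_gt0 sqrtr_gt0.
set k := _^-1 in k0.
exists (k *: p0), u, k; split.
- split.
  + rewrite !formE mulrA -expr2 exprVn sqr_sqrtr ?ltW // mulVf //.
    by rewrite gt_eqF.
  + by rewrite formZl pu0 mulr0.
  + apply: contraNneq D0 => u0; apply/eqP/rowP => i.
    by have /rowP/(_ (lift 0 i)) := u0; rewrite !mxE liftK.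
- by rewrite /head mxE mulr_gt0 // -/(head p0) head_vec4.
- have := plucker_change q p0 u k 0 0 1; rewrite !scale0r scale1r addr0 add0r => ->.
  rewrite mulr1 mulr0 subr0; congr (_ *: _); congr qvec.
    by rewrite !head_vec4 !tail_vec4 scale1r scale0r subr0.
  rewrite !tail_vec4 crossZl cross_anti cross_cross DM scale0r sub0r opprK.
  by rewrite scalerA mulVf ?scale1r // gt_eqF.
Qed.
End Frames.

(** * Hyperbolic space *)

Section Hyperbolic.
Variable R : realType.
Local Notation G := (hyperbolic R).
Local Notation B := (form (-1 : R)).
Implicit Types p u v x : 'rV[R]_4.

Let q_sign : (-1 : R) = -1 \/ (-1 : R) = 1. Proof. by left. Qed.

Lemma lorentzE x y : lorentz x y = - B x y.
Proof. by rewrite /lorentz /form /sdot /head sum3 !mxE; ring. Qed.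

Lemma hyperboloidE p : hyperboloid p <-> B p p = 1 /\ 0 < head p.
Proof.
rewrite /hyperboloid /= lorentzE; split=> -[pp p0]; split=> //; first by apply: oppr_inj.
by rewrite pp.
Qed.

Lemma hyp_frame p u : @direction R G p u <-> frame (-1) p u /\ 0 < head p.
Proof.
rewrite /= lorentzE; split.
  move=> [/hyperboloidE[pp p0] u0 /eqP]; rewrite oppr_eq0 => /eqP pu.
  by split.
by move=> [[pp pu u0] p0]; split=> //; [exact/hyperboloidE | rewrite pu oppr0].
Qed.

(** A geodesic determines its plane: it contains a second point, proportional to
    a p' + u' for a large a. *)
Lemma hyp_geodesic_sub p u p' u' : @direction R G p' u' ->
  @geodesic R G p u = @geodesic R G p' u' -> plane p u p' /\ plane p u u'.
Proof.
move=> dir e.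
have mem x : plane p' u' x -> hyperboloid x -> plane p u x.
  move=> h1 h2; have : @geodesic R G p' u' x by split.
  by rewrite -e => -[].
have hp' : hyperboloid p' by case: dir.
have mp' : plane p u p' by apply: mem hp'; exact: plane_left.
split=> //.
case/hyp_frame: dir => fr p0; have F0 := frame_direction_gt0 q_sign fr.
case: fr => pp' pu' _; have up' : B u' p' = 0 by rewrite formC.
(* a is large enough for a p' + u' to be timelike and to point to the future *)
pose F := -1 * B u' u'; pose a := 1 + F + `|head u'| / head p'.
have c0 : 0 <= `|head u'| / head p' by rewrite divr_ge0 // ltW.
pose y := a *: p' + u'.
have yy : 0 < B y y.
  have -> : B y y = a ^+ 2 - F by rewrite /y !(formDl, formDr, formZl, formZr) pp' pu' up' /F; ring.
  rewrite subr_gt0; apply: (@lt_le_trans _ _ ((1 + F) ^+ 2)).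
    by rewrite -/F in F0; nra.
  by rewrite lerXn2r ?nnegrE ?addr_ge0 ?lerDl //; rewrite -/F in F0; apply: ltW.
have hy : 0 < head y.
  have -> : head y = (1 + F) * head p' + (`|head u'| + head u').
    by rewrite /y /head !mxE /a -/(head p'); field; rewrite gt_eqF.
  rewrite ltr_wpDr //; first by rewrite -[head u']opprK subr_ge0 normrN ler_norm.
  by rewrite mulr_gt0 // addr_gt0.
have py : plane p' u' y by apply/planeP; exists a, 1; rewrite scale1r.
pose k := (Num.sqrt (B y y))^-1.
have k0 : 0 < k by rewrite invr_gt0 sqrtr_gt0.
have ky : plane p u (k *: y).
  apply: mem; first exact: planeZ.
  apply/hyperboloidE; split; last by rewrite /head mxE mulr_gt0.
  rewrite formZl formZr mulrA -expr2 exprVn sqr_sqrtr ?ltW // mulVf //.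
  by rewrite gt_eqF.
have -> : u' = k^-1 *: (k *: y) + (- a) *: p'.
  by rewrite scalerA mulVf ?gt_eqF // scale1r /y scaleNr addrAC subrr add0r.
by apply: memvD; apply: memvZ.
Qed.

Lemma hyp_skewer_coordinates : skewer_coordinates (line_coord (G := G) (plucker (-1))).
Proof.
have geo (p u p' u' : vec G) : direction p u -> direction p' u' ->
    geodesic p u = geodesic p' u' ->
    exists r, plucker (-1) p' u' = qreal (-1) r *: plucker (-1) p u.
  by move=> _ dir /(hyp_geodesic_sub dir)[]; exact: plucker_plane.
apply: line_coord_skewer_coordinates => //; first by left.
- by move=> p u /hyp_frame[/(frame_plucker_unit q_sign)].
- move=> p u v /hyp_frame[[_ pu _] _] _ /= /eqP; rewrite lorentzE oppr_eq0 => /eqP.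
  exact: frame_plucker_orth.
- move=> p u p' u' /hyp_frame[fr _] /hyp_frame[fr' _].
  case/(frame_meet q_sign fr fr') => w [v [v' [fv fv' pv pv' vv']]].
  have w0 : head w != 0.
    apply/negP => /eqP w0; case: fv; rewrite /form w0 mul0r add0r mulN1r => h _ _.
    by have := sdot_ge0 (tail w); rewrite -oppr_le0 h ler10.
  have [wp|wn|/eqP] := ltgtP 0 (head w); last by rewrite eq_sym (negbTE w0).
    exists w, v, v'; split; [exact/hyp_frame|exact/hyp_frame|by rewrite /= pv|
      by rewrite /= pv'|by rewrite /= lorentzE vv' oppr0].
  (* here w lies on the other sheet of the hyperboloid *)
  have neg y : frame (-1) w y -> @direction R G (- w) y.
    case=> ww wy y0; apply/hyp_frame; split; last by rewrite /head mxE oppr_gt0.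
    by split=> //; rewrite -scaleN1r !(formZl, formZr) ?ww ?wy; ring.
  have planeN y : plane w y = plane (- w) y.
    by rewrite -scaleN1r -plane_scalel // oppr_eq0 oner_neq0.
  exists (- w), v, v'; split; [exact: neg|exact: neg|by rewrite /= pv planeN|
    by rewrite /= pv' planeN|by rewrite /= lorentzE vv' oppr0].
- move=> D M D0 DM /(frame_onto D0 DM)[p [u [r [fr p0 pl]]]].
  by exists p, u, r; split=> //; apply/hyp_frame.
- move=> p u p' u' dir dir' /(geo _ _ _ _ dir dir')[r ->].
  by rewrite crossZr cross_sq scaler0.
Qed.
End Hyperbolic.

(** * Elliptic space *)

Section Elliptic.
Variable R : realType.
Local Notation G := (elliptic R).
Local Notation B := (form (1 : R)).
Implicit Types p u v x : 'rV[R]_4.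

Let q_sign : (1 : R) = -1 \/ (1 : R) = 1. Proof. by right. Qed.

Lemma dot4E x y : dot x y = B x y.
Proof. by rewrite /dot /form /sdot /head big_ord_recl sum3 !mxE; ring. Qed.

Lemma ell_frame p u : @direction R G p u <-> frame 1 p u.
Proof. by rewrite /= /sphere /= !dot4E; split=> -[]. Qed.

Lemma dot_gt0 x : x != 0 -> 0 < B x x.
Proof.
move=> x0; rewrite lt0r /form mul1r -expr2 addr_ge0 ?sqr_ge0 ?sdot_ge0 // andbT.
apply: contraNneq x0 => /eqP; rewrite paddr_eq0 ?sqr_ge0 ?sdot_ge0 // sqrf_eq0.
move=> /andP[/eqP h /eqP /sdot_eq0 t]; apply/eqP/eq_vec4.
  by rewrite h /head mxE.
by rewrite t; apply/rowP => i; rewrite !mxE.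
Qed.

(** A cone is recovered from its projectivization: a nonzero x is normalised to a
    unit vector, which lies in Q up to sign. *)
Lemma projectivization_sub (P Q : set 'rV[R]_4) :
  (forall k x, P x -> P (k *: x)) -> (forall k x, Q x -> Q (k *: x)) -> Q 0 ->
  projectivization P = projectivization Q -> (P `<=` Q)%classic.
Proof.
move=> PZ QZ Q0 PQ x Px; have [->//|x0] := eqVneq x 0.
have xx := dot_gt0 x0; pose k := (Num.sqrt (B x x))^-1.
have k0 : k != 0 by rewrite invr_eq0 gt_eqF // sqrtr_gt0.
have kx : sphere (k *: x).
  rewrite /sphere /= dot4E formZl formZr mulrA -expr2 exprVn sqr_sqrtr ?ltW // mulVf //.
  by rewrite gt_eqF.
have : projectivization P (antipodal (k *: x)).
  by exists (k *: x) => //; split=> //; exact: PZ.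
rewrite PQ => -[y [Qy _] e].
have : antipodal (k *: x) y by rewrite -e; left.
move=> yz; have -> : x = k^-1 *: (k *: x) by rewrite scalerA mulVf ?scale1r.
case: yz => yz; apply: (QZ); first by rewrite -yz.
by rewrite -[k *: x]opprK -yz -scaleN1r; exact: QZ.
Qed.

Lemma ell_geodesic_sub p u p' u' : @geodesic R G p u = @geodesic R G p' u' ->
  (plane p' u' `<=` plane p u)%classic.
Proof.
move=> e; apply: projectivization_sub; last exact: esym e.
- by move=> k x; exact: planeZ.
- by move=> k x; exact: planeZ.
- exact: mem0v.
Qed.

Lemma ell_skewer_coordinates : skewer_coordinates (line_coord (G := G) (plucker 1)).
Proof.
have geo (p u p' u' : vec G) : geodesic p u = geodesic p' u' ->
    exists r, plucker 1 p' u' = qreal 1 r *: plucker 1 p u.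
  move=> /ell_geodesic_sub sub.
  by apply: plucker_plane; apply: sub; [exact: plane_left | exact: plane_right].
apply: line_coord_skewer_coordinates => //; first by right; right.
- by move=> p u /ell_frame/(frame_plucker_unit q_sign).
- by move=> p u p' u' _ _; exact: geo.
- move=> p u v /ell_frame[_ pu _] _ /=; rewrite dot4E.
  exact: frame_plucker_orth.
- move=> p u p' u' /ell_frame fr /ell_frame fr'.
  case/(frame_meet q_sign fr fr') => w [v [v' [fv fv' pv pv' vv']]].
  by exists w, v, v'; split; [exact/ell_frame|exact/ell_frame|rewrite /= pv|
    rewrite /= pv'|rewrite /= dot4E vv'].
- move=> D M D0 DM /(frame_onto D0 DM)[p [u [r [fr p0 pl]]]].
  by exists p, u, r; split=> //; apply/ell_frame.
- move=> p u p' u' _ _ [/esym/geo[r ->]|[P [_ lP mP]]].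
    by rewrite crossZr cross_sq scaler0.
  have PZ k x : x \in P -> k *: x \in P by exact: memvZ.
  have subP : (plane p u `<=` [set x | x \in P])%classic.
    by apply: projectivization_sub lP => //; [move=> k x; exact: planeZ | exact: mem0v].
  have subP' : (plane p' u' `<=` orthogonal_complement [set x | x \in P])%classic.
    apply: projectivization_sub mP => //; first by move=> k x; exact: planeZ.
      by move=> k x Px y /Px; rewrite !dot4E formZr => ->; rewrite mulr0.
    by move=> y _; rewrite dot4E -(scale0r y) formZr mul0r.
  have orth x y : plane p u x -> plane p' u' y -> B x y = 0.
    by move=> /subP xP /subP'; rewrite -dot4E; exact.
  have [lp lu] := (plane_left p u, plane_right p u).
  have [lp' lu'] := (plane_left p' u', plane_right p' u').
  by apply: plucker_commutator => //; exact: orth.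
Qed.
End Elliptic.

(** * Pappus' theorem for skewers in the three geometries *)

Theorem theorem1 (R : realType) (X : space_kind)
    (a1 a2 a3 b1 b2 b3 : line (model R X))
    (c12 c21 c13 c31 c23 c32 d12 d13 d23 : line (model R X)) :
  share_skewer a1 a2 a3 ->
  share_skewer b1 b2 b3 ->
  is_S c12 a1 b2 -> is_S c21 a2 b1 ->
  is_S c13 a1 b3 -> is_S c31 a3 b1 ->
  is_S c23 a2 b3 -> is_S c32 a3 b2 ->
  is_S d12 c12 c21 ->
  is_S d13 c13 c31 ->
  is_S d23 c23 c32 ->
  has_unique_skewer d12 d13 \/ has_unique_skewer d12 d23 \/
    has_unique_skewer d13 d23 ->
  share_skewer d12 d13 d23.
Proof.
case: X a1 a2 a3 b1 b2 b3 c12 c21 c13 c31 c23 c32 d12 d13 d23 => /=.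
- exact: skewer_pappus (eucl_skewer_coordinates R).
- exact: skewer_pappus (hyp_skewer_coordinates R).
- exact: skewer_pappus (ell_skewer_coordinates R).
Qed.
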